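(* Let $(S;\eta^{[0]},\ldots,\eta^{[S-1]})$ be one of the three sets of coefficients $(1;0)$, $(2;0,\tfrac12)$, $(3;0,\tfrac34,\tfrac13)$. Let $Z$ be a real vector space with a semi-norm $\|\cdot\|$, and let $z^{n[0]},\ldots,z^{n[S]}\in Z$ be the consequence of time-stepping $z^{n}=z^{n[0]}$ by the convex Euler Runge-Kutta scheme, i.e. for $s=0,\ldots,S-1$ $$z^{n[s+1]}=\eta^{[s]}z^{n[0]}+(1-\eta^{[s]})\,\mathscr{E}(z^{n[s]}),\qquad t^{n[s+1]}=\eta^{[s]}t^{n[0]}+(1-\eta^{[s]})\,(t^{n[s]}+\Delta t^n),$$ with $t^{n[0]}=t^n$, $z^{n+1}=z^{n[S]}$, $t^{n+1}=t^{n[S]}$. Let $\hat z:[t^n,t^n_\star]\to Z$ be a differentiable function, where $t^n_\star=\max_{0\le s<S}(t^{n[s]}+\Delta t^n)$, whose derivative $d\hat z/dt$ possesses a Lipschitz constant $L_z$. If, for some constant $\tilde K\ge 0$, $$\left\|\mathscr{E}(z^{n[s]})-\hat z(t^{n[s]}+\Delta t^n)\right\|\le\left\|z^{n[s]}-\hat z(t^{n[s]})\right\|+\tilde K$$ for all $s\in\{0,1,\ldots,S-1\}$, then $$\left\|z^{n+1}-\hat z(t^{n+1})\right\|\le\left\|z^{n}-\hat z(t^{n})\right\|+\tilde K+\frac{7+9S}{12+4S}\,L_z\,(\Delta t^n)^2 .$$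
   Context: $\Delta t^n>0$ is the time-step size and $t^n$ the initial time of the step. $\mathscr{E}(z^{n[s]})\in Z$ denotes the Euler time-step of $z^{n[s]}$ by the interval $\Delta t^n$, i.e. the approximation at time $t^{n[s]}+\Delta t^n$ of the solution starting from $z^{n[s]}$ at time $t^{n[s]}$. Differentiability of $\hat z$ and the Lipschitz constant of its derivative are understood with respect to the semi-norm $\|\cdot\|$ on $Z$: $\|\hat z'(t)-\hat z'(t')\|\le L_z|t-t'|$. *)

(* Defs.v *)
From mathcomp Require Import all_boot all_order all_algebra.
From mathcomp Require Import all_classical all_reals all_analysis.

Set Implicit Arguments.
Unset Strict Implicit.
Unset Printing Implicit Defensive.

Import Order.TTheory GRing.Theory Num.Theory.
Import numFieldNormedType.Exports.

Local Open Scope classical_set_scope.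
Local Open Scope ring_scope.

(* [semiNormedZmodType] has no compatibility with the scaling by [R], and it
   has no join with [lmodType R] except [normedModType R], whose norm separates
   points; hence a semi-norm is a function on an [lmodType R].
   [0 <= nrm x] and [nrm 0 = 0] follow from the two axioms. *)
Record is_seminorm (R : realType) (Z : lmodType R) (nrm : Z -> R) : Prop := {
  seminorm_triangle : forall x y : Z, nrm (x + y) <= nrm x + nrm y ;
  seminorm_scale : forall (a : R) (x : Z), nrm (a *: x) = `|a| * nrm x
}.

(* [z] is only considered on [A], so the derivative is one-sided at the end
   points of an interval. As [nrm] need not separate points, [dz] is determined
   only up to vectors of semi-norm 0. *)
Definition is_derivative_within (R : realType) (Z : lmodType R) (nrm : Z -> R)
    (A : set R) (z : R -> Z) (t : R) (dz : Z) : Prop :=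
  nrm ((u - t)^-1 *: (z u - z t) - dz) @[u --> within A t^'] --> (0 : R).

Definition convex_euler_coeffs (R : realType) (S : nat) (eta : seq R) : Prop :=
  [\/ (S, eta) = (1%N, [:: 0]),
      (S, eta) = (2%N, [:: 0; 1 / 2]) |
      (S, eta) = (3%N, [:: 0; 3 / 4; 1 / 3])].

(* [E t z] is the Euler time-step of [z] from time [t] over the interval [dt];
   only the values [tt s] and [z s] for [s <= S] matter. *)
Definition convex_euler_rk (R : realType) (Z : lmodType R)
    (S : nat) (eta : seq R) (dt : R) (E : R -> Z -> Z)
    (tt : nat -> R) (z : nat -> Z) : Prop :=
  forall s : nat, (s < S)%N ->
    z s.+1 = eta`_s *: z 0%N + (1 - eta`_s) *: E (tt s) (z s) /\
    tt s.+1 = eta`_s * tt 0%N + (1 - eta`_s) * (tt s + dt).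

(* As [0 < S], the default value of the maximum is one of its terms. *)
Definition tstar (R : realType) (S : nat) (dt : R) (tt : nat -> R) : R :=
  \big[Num.max/tt 0%N + dt]_(s < S) (tt s + dt).

(* Main.v *)
Require Import Defs.
From mathcomp Require Import all_boot all_order all_algebra.
From mathcomp Require Import all_classical all_reals all_analysis.
From mathcomp Require Import ring lra.
Import Order.TTheory GRing.Theory Num.Theory.
Import numFieldNormedType.Exports.
Local Open Scope classical_set_scope.
Local Open Scope ring_scope.

(** In the error after one stage, [z (s+1) - zhat (tt (s+1))], both the iterate
    and its time are the same convex combination, with weights [eta] and
    [1 - eta], of the data at the initial time [t0 = tt 0] and of an Euler step
    ending at [t1 = tt s + dt].  Hence the error is at most the convex
    combination of the two earlier errors plus the interpolation defect
      [eta * zhat t0 + (1 - eta) * zhat t1 - zhat (eta * t0 + (1 - eta) * t1)].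
    Expanding [zhat] to first order about the intermediate time, the linear
    terms cancel because the weighted mean of the increments vanishes, and the
    remainders, at most [Lz] times the squared increments, add up to the
    variance of the two-point distribution:
      [Lz * eta * (1 - eta) * (t1 - t0)^2]
    ([nrm_convex_step]).

    Running this through the stages, the errors of the initial value and the
    constants [K] combine to exactly [nrm (zn - zhat tn) + K], while the defects
    add up to [0] for [S = 1], to [1/4 * 2^2 = 1] for [S = 2], and to
    [2/3 * (3/16 * 2^2) + 2/9 * (3/2)^2 = 1] for [S = 3], in units of
    [Lz * dt^2].  These are below the claimed [1], [5/4] and [17/12].

    The remainder bound is a mean value inequality
    ([nrm_mean_value_inequality]).  As the space carries only a semi-norm and
    [zhat] is differentiable only relative to the interval, it is obtained from
    the completeness of the reals: the set of end points for which the
    inequality holds with a slightly larger slope has a supremum, and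
    differentiability there prevents it from lying before the end of the
    interval. *)

(** * Semi-norms *)

Section Seminorm.
Set Implicit Arguments.
Unset Strict Implicit.
Variables (R : realType) (Z : lmodType R) (nrm : Z -> R).
Hypothesis nrmP : is_seminorm nrm.

Lemma seminorm0 : nrm 0 = 0.
Proof. by rewrite -(scale0r (0 : Z)) (seminorm_scale nrmP) normr0 mul0r. Qed.

Lemma seminormN x : nrm (- x) = nrm x.
Proof. by rewrite -scaleN1r (seminorm_scale nrmP) normrN1 mul1r. Qed.

Lemma seminorm_ge0 x : 0 <= nrm x.
Proof.
have := seminorm_triangle nrmP x (- x).
by rewrite subrr seminorm0 seminormN; lra.
Qed.

(** * First-order expansion *)

(** The increment form of the derivative is free of quotients, and so it also
    holds at [u = t]. *)
Lemma derivative_within_increment (A : set R) (f : R -> Z) (t : R) (df : Z)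
    (e : R) :
  is_derivative_within nrm A f t df -> 0 < e ->
  exists2 d, 0 < d & forall u, A u -> `|u - t| < d ->
    nrm (f u - f t - (u - t) *: df) <= e * `|u - t|.
Proof.
move=> /cvgrPdist_lt /(_ e) fdf e0.
have /nbhs_ballP[d d0 fd] := fdf e0.
exists d => // u Au utd.
have [->|ut] := eqVneq u t.
  by rewrite !subrr scale0r subrr seminorm0 normr0 mulr0.
have /(_ _ ut Au) := fd u _.
rewrite /ball /= distrC => /(_ utd).
rewrite sub0r normrN (ger0_norm (seminorm_ge0 _)) => /ltW fe.
have ut0 : u - t != 0 by rewrite subr_eq0.
have -> : f u - f t - (u - t) *: df =
    (u - t) *: ((u - t)^-1 *: (f u - f t) - df).
  by rewrite scalerBr scalerA divff// scale1r.
by rewrite (seminorm_scale nrmP) mulrC ler_wpM2r.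
Qed.

Lemma opp_increment (f : R -> Z) (w : Z) (a b : R) :
  - (f b - f a - (b - a) *: w) = f a - f b - (a - b) *: w.
Proof.
by rewrite -(opprB b a) scaleNr opprK [LHS]opprB [LHS]addrC opprB.
Qed.

Lemma seminorm_increment_split (f : R -> Z) (w : Z) (a b c : R) :
  nrm (f b - f a - (b - a) *: w) <=
  nrm (f c - f a - (c - a) *: w) + nrm (f b - f c - (b - c) *: w).
Proof.
apply: le_trans (seminorm_triangle nrmP _ _); rewrite le_eqVlt; apply/orP; left.
apply/eqP; congr nrm.
rewrite addrACA -opprD -scalerDl; congr (_ - _ *: _); last by ring.
by rewrite addrC addrA subrK.
Qed.

(** Near each point [c] the inequality holds, with slope [M + e], for increments
    starting at [c], and such bounds add up over consecutive increments.  Let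
    [T] be the set of end points reached from [a] with slope [M + e].  Going
    through a point of [T] just below its supremum shows that the supremum
    belongs to [T]; one more increment would go beyond it, unless it is [b]. *)
Lemma nrm_mean_value_inequality (A : set R) (f df : R -> Z) (w : Z)
    (a b M : R) :
  a <= b -> `[a, b] `<=` A ->
  (forall t, t \in `[a, b] -> is_derivative_within nrm A f t (df t)) ->
  (forall t, t \in `[a, b] -> nrm (df t - w) <= M) ->
  nrm (f b - f a - (b - a) *: w) <= M * (b - a).
Proof.
move=> ab abA fdf dfM.
have local_bound c e : c \in `[a, b] -> 0 < e -> exists2 d, 0 < d &
    forall u, u \in `[a, b] -> `|u - c| < d ->
      nrm (f u - f c - (u - c) *: w) <= (M + e) * `|u - c|.
  move=> cab e0; have [d d0 fd] := derivative_within_increment (fdf c cab) e0.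
  exists d => // u uab uc; have {}fd := fd u (abA u uab) uc.
  have -> : f u - f c - (u - c) *: w =
      (f u - f c - (u - c) *: df c) + (u - c) *: (df c - w).
    by rewrite scalerBr addrA subrK.
  apply: le_trans (seminorm_triangle nrmP _ _) _.
  rewrite (seminorm_scale nrmP) [leRHS]mulrDl addrC.
  by apply: lerD => //; rewrite mulrC ler_wpM2r ?dfM.
suff slope e : 0 < e ->
    nrm (f b - f a - (b - a) *: w) <= (M + e) * (b - a).
  apply/ler_addgt0Pl => e e0.
  have ba1 : 0 < b - a + 1 by lra.
  apply: le_trans (slope (e / (b - a + 1)) (divr_gt0 e0 ba1)) _.
  rewrite mulrDl addrC lerD2r mulrAC ler_pdivrMr// ler_pM2l//; lra.
move=> e0.
pose T := [set t | t \in `[a, b] /\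
  nrm (f t - f a - (t - a) *: w) <= (M + e) * (t - a)].
have Ta : T a.
  by split; rewrite ?bound_itvE// !subrr scale0r subrr seminorm0 mulr0.
have T_sup : has_sup T.
  by split; [exists a | exists b => t [/itvP tab _]; rewrite tab].
pose c := sup T.
have ac : a <= c by apply: (ub_le_sup T_sup.2).
have cb : c <= b.
  by apply: ge_sup; [exists a | move=> t [/itvP tab _]; rewrite tab].
have cab : c \in `[a, b] by rewrite in_itv /= ac cb.
have [d d0 fd] := local_bound c e cab e0.
have Tc : T c.
  have [u Tu cu] := sup_adherent d0 T_sup.
  have uc : u <= c := ub_le_sup T_sup.2 Tu.
  have [uab fu] := Tu.
  split=> //; apply: le_trans (seminorm_increment_split _ _ _ _ u) _.
  have {}cu : c - d < u := cu.
  rewrite -[in X in _ + X]opp_increment seminormN.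
  have := fd u uab; rewrite ler0_norm; last by lra.
  move=> /(_ _)/wrap[|fuc]; first by lra.
  have -> : c - a = (u - a) + - (u - c) by ring.
  by rewrite mulrDr; apply: lerD.
have [bc|cb'] := leP b c.
  by have [_] := Tc; have -> : c = b by lra.
pose v := Num.min b (c + d / 2).
have cv : c < v by rewrite lt_min cb' /=; lra.
have vb : v <= b by rewrite ge_min lexx.
have vd : v <= c + d / 2 by rewrite ge_min lexx orbT.
have vab : v \in `[a, b] by rewrite in_itv /= vb andbT; lra.
suff Tv : T v by have : v <= c := ub_le_sup T_sup.2 Tv; lra.
split=> //; apply: le_trans (seminorm_increment_split _ _ _ _ c) _.
have := fd v vab; rewrite ger0_norm; last by lra.
move=> /(_ _)/wrap[|fvc]; first by lra.
have -> : v - a = (c - a) + (v - c) by ring.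
by rewrite mulrDr; apply: lerD => //; case: Tc.
Qed.

Section Lipschitz.
Variables (p q L : R) (f df : R -> Z).
Hypothesis f_derivative : forall t, t \in `[p, q] ->
  is_derivative_within nrm `[p, q] f t (df t).
Hypothesis df_lipschitz : forall t t', t \in `[p, q] -> t' \in `[p, q] ->
  nrm (df t - df t') <= L * `|t - t'|.

Lemma lipschitz_constant_ge0 : p < q -> 0 <= L.
Proof.
move=> pq; have := df_lipschitz (t := q) (t' := p).
rewrite !bound_itvE (ltW pq).
move=> /(_ isT isT) /(le_trans (seminorm_ge0 _)).
by rewrite pmulr_lge0// normr_gt0 subr_eq0 gt_eqF.
Qed.

(** The sharp constant is [L / 2]; the mean value inequality yields [L], which
    is enough for the error bound of the scheme. *)
Lemma nrm_first_order_remainder (s t : R) : p < q ->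
  s \in `[p, q] -> t \in `[p, q] ->
  nrm (f t - f s - (t - s) *: df s) <= L * (t - s) ^+ 2.
Proof.
move=> pq; have L0 := lipschitz_constant_ge0 pq.
move=> spq tpq; have [/andP[ps sq] /andP[pt tq]] :
  (p <= s <= q) /\ (p <= t <= q) by move: spq tpq; rewrite !in_itv.
have sub x y u : p <= x -> y <= q -> u \in `[x, y] -> u \in `[p, q].
  by rewrite !in_itv /= => px yq /andP[xu uy]; apply/andP; split; lra.
have [st|ts] := leP s t.
  rewrite expr2 mulrA.
  apply: (nrm_mean_value_inequality (A := `[p, q]) (df := df)) => //.
  - by move=> u; apply: sub.
  - by move=> u /(sub _ _ _ ps tq); apply: f_derivative.
  - move=> u ust; apply: le_trans (df_lipschitz (sub _ _ _ ps tq ust) spq) _.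
    move: ust; rewrite in_itv /= => /andP[su ut].
    by rewrite ler_wpM2l// ger0_norm; lra.
have -> : L * (t - s) ^+ 2 = L * (s - t) * (s - t) by ring.
rewrite -opp_increment seminormN.
apply: (nrm_mean_value_inequality (A := `[p, q]) (df := df)) => //.
- exact: ltW.
- by move=> u; apply: sub.
- by move=> u /(sub _ _ _ pt sq); apply: f_derivative.
- move=> u uts; apply: le_trans (df_lipschitz (sub _ _ _ pt sq uts) spq) _.
  move: uts; rewrite in_itv /= => /andP[tu us].
  by rewrite ler_wpM2l// ler0_norm; lra.
Qed.

(** * Convex combinations and the error of one stage *)

Lemma convex_sub_expansion (eta t0 t1 : R) (x y : Z) :
  let t := eta * t0 + (1 - eta) * t1 in
  eta *: x + (1 - eta) *: y - f t =
  (eta *: (x - f t0) + (1 - eta) *: (y - f t1)) +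
  (eta *: (f t0 - f t - (t0 - t) *: df t) +
   (1 - eta) *: (f t1 - f t - (t1 - t) *: df t)).
Proof.
move=> t; rewrite addrACA -!scalerDr !addrA !subrK.
rewrite !(scalerBr _ _ (_ *: _)) !scalerA addrACA -opprD -scalerDl.
(* the weighted mean of the increments [t0 - t] and [t1 - t] is zero *)
have -> : eta * (t0 - t) + (1 - eta) * (t1 - t) = 0 by rewrite /t; ring.
rewrite scale0r subr0 !scalerBr addrACA -opprD -scalerDl.
by rewrite [eta + _]addrC subrK scale1r.
Qed.

(** The factor [eta * (1 - eta) * (t1 - t0) ^+ 2] is the variance of the
    distribution with weights [eta] at [t0] and [1 - eta] at [t1]: it is the
    weighted mean of the squared increments in the two remainders. *)
Lemma nrm_convex_step (eta t0 t1 : R) (x y : Z) : p < q ->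
  0 <= eta <= 1 -> t0 \in `[p, q] -> t1 \in `[p, q] ->
  nrm (eta *: x + (1 - eta) *: y - f (eta * t0 + (1 - eta) * t1)) <=
  eta * nrm (x - f t0) + (1 - eta) * nrm (y - f t1) +
  L * (eta * (1 - eta) * (t1 - t0) ^+ 2).
Proof.
move=> pq /andP[eta0 eta1] t0pq t1pq; set t := eta * t0 + _.
have eta'0 : 0 <= 1 - eta by lra.
have tpq : t \in `[p, q].
  move: t0pq t1pq; rewrite !in_itv /= => /andP[? ?] /andP[? ?].
  by rewrite /t; apply/andP; split; nra.
have nrm_convex u v : nrm (eta *: u + (1 - eta) *: v) <=
    eta * nrm u + (1 - eta) * nrm v.
  apply: le_trans (seminorm_triangle nrmP _ _) _.
  by rewrite !(seminorm_scale nrmP) !ger0_norm.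
rewrite convex_sub_expansion -/t.
apply: le_trans (seminorm_triangle nrmP _ _) _.
apply: lerD (nrm_convex _ _) _; apply: le_trans (nrm_convex _ _) _.
have -> : L * (eta * (1 - eta) * (t1 - t0) ^+ 2) =
    eta * (L * (t0 - t) ^+ 2) + (1 - eta) * (L * (t1 - t) ^+ 2).
  by rewrite /t; ring.
by apply: lerD; rewrite ler_wpM2l// nrm_first_order_remainder.
Qed.

End Lipschitz.
End Seminorm.

(** * The scheme *)

Theorem theorem2p1 (R : realType) (Z : lmodType R)
    (nrm : Z -> R) (nrm_seminorm : is_seminorm nrm)
    (S : nat) (eta : seq R) (eta_coeffs : convex_euler_coeffs S eta)
    (E : R -> Z -> Z) (tn dt : R) (dt_gt0 : 0 < dt) (zn : Z)
    (tt : nat -> R) (z : nat -> Z) (tt0 : tt 0%N = tn) (z0 : z 0%N = zn)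
    (rk : convex_euler_rk S eta dt E tt z)
    (zhat dzhat : R -> Z)
    (zhat_derivative : forall t : R, t \in `[tn, tstar S dt tt] ->
      is_derivative_within nrm `[tn, tstar S dt tt] zhat t (dzhat t))
    (Lz : R)
    (dzhat_lipschitz : forall t t' : R,
      t \in `[tn, tstar S dt tt] -> t' \in `[tn, tstar S dt tt] ->
      nrm (dzhat t - dzhat t') <= Lz * `|t - t'|)
    (K : R) (K_ge0 : 0 <= K)
    (E_step : forall s : nat, (s < S)%N ->
      nrm (E (tt s) (z s) - zhat (tt s + dt)) <= nrm (z s - zhat (tt s)) + K) :
  nrm (z S - zhat (tt S)) <=
    nrm (zn - zhat tn) + K + (7 + 9 * S%:R) / (12 + 4 * S%:R) * Lz * dt ^+ 2.
Proof.
pose err s := nrm (z s - zhat (tt s)).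
have le_tstar s : (s < S)%N -> tt s + dt <= tstar S dt tt.
  by move=> sS; apply: (le_bigmax _ (fun i : 'I_S => tt i + dt) (Ordinal sS)).
have S_gt0 : (0 < S)%N by case: eta_coeffs => -[-> _].
have tn_tstar : tn < tstar S dt tt.
  by apply: lt_le_trans (le_tstar 0%N S_gt0); rewrite tt0; lra.
have Lz_ge0 : 0 <= Lz :=
  lipschitz_constant_ge0 nrm_seminorm dzhat_lipschitz tn_tstar.
have LD_ge0 : 0 <= Lz * dt ^+ 2 by rewrite mulr_ge0// exprn_ge0// ltW.
have stage s c : (s < S)%N -> 0 <= eta`_s <= 1 -> 0 <= c ->
    tt s = tn + c * dt -> [/\ tt s.+1 = tn + (1 - eta`_s) * (c + 1) * dt &
    err s.+1 <= eta`_s * err 0%N + (1 - eta`_s) * (err s + K) +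
      eta`_s * (1 - eta`_s) * (c + 1) ^+ 2 * (Lz * dt ^+ 2)].
  move=> sS etas c0 ts; have [zs1 ts1] := rk s sS.
  split; first by rewrite ts1 tt0 ts; ring.
  rewrite /err zs1 ts1.
  apply: le_trans (nrm_convex_step nrm_seminorm zhat_derivative
    dzhat_lipschitz _ _ tn_tstar etas _ _) _.
  - by rewrite tt0 in_itv /= lexx ltW.
  - by rewrite in_itv /= le_tstar// andbT ts; nra.
  apply: lerD; last first.
    by rewrite tt0 ts le_eqVlt; apply/orP; left; apply/eqP; ring.
  by rewrite lerD2l ler_wpM2l ?E_step//; move/andP: etas => [_]; lra.
have -> : nrm (zn - zhat tn) = err 0%N by rewrite /err z0 tt0.
have t0 : tt 0%N = tn + 0 * dt by rewrite tt0; ring.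
rewrite -[nrm _]/(err S) -mulrA.
move: (Lz * dt ^+ 2) LD_ge0 stage => D D0 stage.
case: eta_coeffs => -[SE etaE]; move: stage; rewrite SE etaE => stage.
- have [|_ /= e1] := stage 0%N 0 isT _ (lexx 0) t0; first by rewrite /=; lra.
  have -> : (7 + 9 * 1) / (12 + 4 * 1) = 1 :> R by field.
  lra.
- have [|t1 /= e1] := stage 0%N 0 isT _ (lexx 0) t0; first by rewrite /=; lra.
  have [||| _ /= e2] := stage 1%N 1 isT.
  + by rewrite /=; lra.
  + by [].
  + by rewrite t1 /=; ring.
  have -> : (7 + 9 * 2) / (12 + 4 * 2) = 5 / 4 :> R by field.
  lra.
- have [|t1 /= e1] := stage 0%N 0 isT _ (lexx 0) t0; first by rewrite /=; lra.
  have [||| t2 /= e2] := stage 1%N 1 isT.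
  + by rewrite /=; lra.
  + by [].
  + by rewrite t1 /=; ring.
  have [||| _ /= e3] := stage 2%N (1 / 2) isT.
  + by rewrite /=; lra.
  + by lra.
  + by rewrite t2 /=; field.
  have -> : (7 + 9 * 3) / (12 + 4 * 3) = 17 / 12 :> R by field.
  lra.
Qed.
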